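(* Let $n>k>t$ be positive integers and suppose that the nonempty family $\mathcal F\subset\binom{[n]}{k}$ is a $t$-intersecting $(t+1)$-semistar. Then for all integers $1<j<t$, $$\frac{|\partial^j\mathcal F|}{|\mathcal F|}\ \ge\ \frac{1}{t+2}\binom{t+2}{j+1}.$$
   Context: $[n]=\{1,\dots,n\}$, and $\binom{[n]}{k}$ is the collection of all $k$-element subsets of $[n]$. A family $\mathcal F\subset\binom{[n]}{k}$ is $t$-intersecting if $|F\cap F'|\ge t$ for all $F,F'\in\mathcal F$. The $j$'th shadow is $\partial^j\mathcal F=\{G\in\binom{[n]}{k-j} : \exists F\in\mathcal F,\ G\subset F\}$. $\mathcal F$ is a $(t+1)$-semistar if there is a $(t+1)$-element set $D\subset[n]$ such that $|F\cap D|\ge t$ for all $F\in\mathcal F$. *)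

(* Defs.v *)
From mathcomp Require Import all_boot all_order all_algebra.

Set Implicit Arguments.
Unset Strict Implicit.
Unset Printing Implicit Defensive.

(* The ground set [n] is represented by 'I_n. *)

Definition ksubsets (n k : nat) : {set {set 'I_n}} :=
  [set A : {set 'I_n} | #|A| == k].

Definition t_intersecting (n t : nat) (F : {set {set 'I_n}}) : Prop :=
  forall A B : {set 'I_n}, A \in F -> B \in F -> t <= #|A :&: B|.

(* The j-th shadow of a family of k-sets; the uniformity k is an explicit
   argument, and the subtraction k - j is only meaningful for j <= k. *)
Definition shadow (n k j : nat) (F : {set {set 'I_n}}) : {set {set 'I_n}} :=
  [set G in ksubsets n (k - j) | [exists A in F, G \subset A]].

(* [semistar t F] says that F is a (t+1)-semistar: the argument is t, and the
   witnessing set D has t+1 elements. *)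
Definition semistar (n t : nat) (F : {set {set 'I_n}}) : Prop :=
  exists D : {set 'I_n},
    #|D| = t.+1 /\ forall A : {set 'I_n}, A \in F -> t <= #|A :&: D|.

(* Main.v *)
(* Let D witness the semistar, N = t+1, s = k-t.  For an s-set x disjoint from D
   let I(x) be the set of i in D with x u (D\i) in F, and let A be the set of y
   disjoint from D with y u D in F; so |F| = |A| + sum_x |I(x)|.  The shadow
   contains (D\S) u x whenever |S| = j+1 and S meets I(x), that is at least
     C(N,j+1) - C(N-|I(x)|,j+1) >= C(N,j)/(j+1) * min(|I(x)|, N-j)
   sets for each x.  Let H be the set of x with |I(x)| > N-j, on which this falls
   short.  If |S| = j and x is in H then S meets I(x), so the shadow also
   contains (D\S) u y for every y in A or in the shadow of H.  If x and y are in H,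
   there are distinct i in I(x) and l in I(y), and t-intersection of x u (D\i) and
   y u (D\l) makes x and y meet; so H is intersecting, hence |shadow H| >= |H|
   (Katona), and the C(N,j)|A u shadow H| new sets compensate the loss, which is at most j C(N,j)/(j+1) per x in H. *)

Require Import Defs.
From mathcomp Require Import all_boot all_order all_algebra.

Set Implicit Arguments.
Unset Strict Implicit.
Unset Printing Implicit Defensive.

Import Order.TTheory GRing.Theory Num.Theory.
Local Open Scope ring_scope.

(** * Katona's shadow bound by linear algebra *)

(** The premise says that the rows of the matrix [w] on [A] and [B] are linearly independent, so its
    rank [#|A|] is at most the number of columns. *)
Lemma leq_card_of_free (R : fieldType) (I J : finType) (A : {set I})
    (B : {set J}) (w : I -> J -> R) :
  (forall c : I -> R,
     (forall b, b \in B -> \sum_(a in A) c a * w a b = 0) ->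
     forall a, a \in A -> c a = 0) ->
  (#|A| <= #|B|)%N.
Proof.
move=> free_w; case: (set_0Vmem A) => [-> | [a0 a0A]]; first by rewrite cards0.
pose W := \matrix_(a < #|A|, b < #|B|) w (enum_val a) (enum_val b).
suff /eqP <- : row_free W by exact: rank_leq_col.
apply: inj_row_free => v vW0; apply/rowP => r; rewrite mxE.
rewrite -(enum_valK_in a0A r).
apply: (free_w (fun a => v 0 (enum_rank_in a0A a))) (enum_valP r) => b bB.
transitivity ((v *m W) 0 (enum_rank_in bB b)); last by rewrite vW0 mxE.
rewrite big_enum_val mxE; apply: eq_bigr => i _.
by rewrite enum_valK_in !mxE enum_rankK_in.
Qed.

(** Toggling a fixed [x] of [X] pairs subsets with opposite signs. *)
Lemma sum_sign_subsets (R : nzRingType) (T : finType) (X : {set T}) :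
  X != set0 -> \sum_(S : {set T} | S \subset X) (-1) ^+ #|S| = 0 :> R.
Proof.
case/set0Pn=> x xX.
rewrite (bigID (fun S : {set T} => x \in S)) /=.
rewrite (reindex_onto (fun S => x |: S) (fun S => S :\ x)) /=; last first.
  by move=> S /andP[_ xS]; rewrite setD1K.
apply/eqP; rewrite addr_eq0 -sumrN; apply/eqP.
have iffS (S : {set T}) : (x |: S \subset X) && (x \in x |: S) && ((x |: S) :\ x == S)
    = (S \subset X) && (x \notin S).
  rewrite setU11 andbT subUset sub1set xX /=.
  case: (boolP (x \in S)) => xS; last by rewrite setU1K ?eqxx.
  rewrite andbF; apply/negP => /andP[_ /eqP eS].
  by move: xS; rewrite -eS setD11.
rewrite (eq_bigl _ _ iffS); apply: eq_bigr => S /andP[_ xS].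
by rewrite cardsU1 xS exprS mulN1r.
Qed.

(* Katona's bound by linear independence: if c on H has zero sum over the
   supersets of each (s-1)-set, then also over those of each smaller set T;
   weighting by (-1)^|T| over the proper subsets T of B in H leaves only c B,
   because A n B is a nonempty proper subset of B for the other A in H. *)
Lemma intersecting_leq_shadow (n s : nat) (H : {set {set 'I_n}}) :
  H \subset ksubsets n s -> t_intersecting 1 H ->
  (#|H| <= #|shadow s 1 H|)%N.
Proof.
move=> /subsetP Hs Hint.
have cardH (A : {set 'I_n}) : A \in H -> #|A| = s by move/Hs; rewrite inE => /eqP.
pose w (A U : {set 'I_n}) : rat := (U \subset A)%:R.
apply: (@leq_card_of_free _ _ _ H (shadow s 1 H) w) => c c0; rewrite /w in c0.
have sum0 (m : nat) : forall T : {set 'I_n}, (#|T| + m.+1)%N = s ->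
    \sum_(A in H) c A * (T \subset A)%:R = 0.
  elim: m => [|m IHm] T cT.
    case: (boolP (T \in shadow s 1 H)) => [/c0 //|].
    rewrite !inE -cT addn1 subn1 eqxx /= => /existsPn nT.
    by apply: big1 => A AH; have := nT A; rewrite AH /= => /negbTE ->; rewrite mulr0.
  (* Sum over the one-point extensions of [T]: each [A] in [H] containing [T] is counted
     [#|A :\: T| = m + 2] times, a nonzero factor in [rat]. *)
  have: \sum_(x | x \notin T) \sum_(A in H) c A * (x |: T \subset A)%:R = 0.
    apply: big1 => x xT; apply: IHm.
    by rewrite cardsU1 xT add1n addSnnS.
  rewrite exchange_big /=.
  suff E A : A \in H -> \sum_(x | x \notin T) c A * (x |: T \subset A)%:R
                     = m.+2%:R * (c A * (T \subset A)%:R).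
    rewrite (eq_bigr _ E) -mulr_sumr => /eqP.
    by rewrite mulf_eq0 pnatr_eq0 => /eqP.
  move=> AH; rewrite -mulr_sumr mulrCA; congr (_ * _).
  case: (boolP (T \subset A)) => TA; last first.
    rewrite mulr0; apply: big1 => x _.
    by rewrite subUset (negbTE TA) andbF.
  rewrite mulr1 -natr_sum; congr (_%:R).
  rewrite (eq_bigr (fun x => (x \in A) : nat)); last first.
    by move=> x _; rewrite subUset sub1set TA andbT.
  rewrite -big_mkcondr sum1_card /=.
  have -> : #|[pred x | (x \notin T) && (x \in A)]| = #|A :\: T|.
    by apply: eq_card => x; rewrite !inE.
  by rewrite cardsD (setIidPr TA) cardH // -cT addKn.
move=> B BH.
have: \sum_(T : {set 'I_n} | T \proper B)
        (-1) ^+ #|T| * \sum_(A in H) c A * (T \subset A)%:R = 0.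
  apply: big1 => T /proper_card; rewrite (cardH B BH) => cT.
  rewrite (sum0 (s - #|T|).-1) ?mulr0 //.
  by rewrite prednK ?subn_gt0 // subnKC // ltnW.
under eq_bigr do rewrite mulr_sumr.
rewrite exchange_big /= (bigD1 B) //= [X in _ + X]big1 => [|A /andP[AH AB]].
  under eq_bigr => T TB do rewrite (proper_sub TB) mulr1.
  rewrite addr0 -mulr_suml => /eqP.
  have /(sum_sign_subsets rat) : B != set0.
    by have:= Hint B B BH BH; rewrite setIid card_gt0.
  rewrite (bigD1 B) //= => /eqP; rewrite addrC addr_eq0 => /eqP.
  rewrite (eq_bigl (fun T : {set _} => T \proper B)) => [->|T]; last first.
    by rewrite properEneq andbC.
  by rewrite mulNr oppr_eq0 mulf_eq0 signr_eq0 => /eqP.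
rewrite -[RHS](mulr0 (c A)).
rewrite -[in RHS](sum_sign_subsets rat (X := A :&: B)); last first.
  by rewrite -card_gt0; apply: Hint.
rewrite mulr_sumr (bigID (fun T : {set 'I_n} => T \subset A)) /=.
rewrite [X in _ + X]big1 => [|T]; last first.
  by case/andP=> _ /negbTE->; rewrite !mulr0.
rewrite addr0; apply: eq_big => [T|T /andP[_ ->]]; last by rewrite mulr1 mulrC.
rewrite subsetI andbC; case: (boolP (T \subset A)) => //= TA.
rewrite properEneq; case: eqP => //= eTB; rewrite eTB in TA *.
by move: AB; rewrite eq_sym eqEcard TA !cardH // leqnn.
Qed.

(** * Binomial counts and splitting sets along [D] *)

Local Open Scope nat_scope.

Lemma card_dep_pairs (I J : finType) (P : I -> {set J}) :
  #|[set p : I * J | p.2 \in P p.1]| = \sum_i #|P i|.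
Proof.
rewrite -sum1_card; under [RHS]eq_bigr do rewrite -sum1_card.
by rewrite pair_big_dep; apply: eq_bigl => p; rewrite inE.
Qed.

Lemma card_draws_meeting (T : finType) (D I : {set T}) (m : nat) :
  I \subset D ->
  #|[set S : {set T} | [&& S \subset D, #|S| == m & ~~ [disjoint S & I]]]|
    = 'C(#|D|, m) - 'C(#|D| - #|I|, m).
Proof.
move=> sID; rewrite -[in #|D| - _](setIidPr sID) -cardsD -!cards_draws.
set X := [set A : {set T} | A \subset D & #|A| == m].
set Y := [set A : {set T} | A \subset D :\: I & #|A| == m].
have sYX : Y \subset X.
  by apply/subsetP => S; rewrite !inE subsetD => /andP[/andP[-> _] ->].
rewrite -{1}(setIidPr sYX) -cardsD; apply: eq_card => S; rewrite !inE subsetD.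
by case: (S \subset D); case: (#|S| == m); rewrite /= ?andbF ?andbT.
Qed.

(** Use [(j+1) C(m,j+1) = (m-j) C(m,j)] for [m = N] and [m = N-d], then bound [C(N-d,j)] by
    [C(N,j)]; truncation of [N-d-j] at 0 produces the minimum. *)
Lemma leq_bin_meeting (N j d : nat) : d <= N ->
  'C(N, j) * minn d (N - j) <= j.+1 * ('C(N, j.+1) - 'C(N - d, j.+1)).
Proof.
move=> dN; rewrite mulnBr !mul_bin_left leq_subRL; last first.
  by rewrite leq_mul ?leq_sub2r ?leq_subr // leq_bin2l ?leq_subr.
rewrite (@leq_trans ((N - d - j) * 'C(N, j) + 'C(N, j) * minn d (N - j))) //.
  by rewrite leq_add2r leq_mul2l leq_bin2l ?leq_subr ?orbT.
rewrite ['C(N, j) * minn _ _]mulnC -mulnDl leq_mul2r subnAC.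
case: (leqP d (N - j)) => [dNj | /ltnW Njd]; first by rewrite subnK // leqnn orbT.
by rewrite (eqP Njd) add0n leqnn orbT.
Qed.

(** With [setUD_inner], this recovers [(x, S)] from [x :|: (D :\: S)], so that distinct pairs give
    distinct shadow members. *)
Lemma setUD_outer (T : finType) (x D S : {set T}) :
  [disjoint x & D] -> (x :|: (D :\: S)) :\: D = x.
Proof.
move=> xD; rewrite setDUl setDDl setDUr setDv setI0 setU0.
by apply/setDidPl.
Qed.

Lemma setUD_inner (T : finType) (x D S : {set T}) :
  [disjoint x & D] -> S \subset D -> D :\: (x :|: (D :\: S)) = S.
Proof.
rewrite disjoint_sym => xD SD.
by rewrite -setDDl (setDidPl xD) setDDr setDv set0U; apply/setIidPr.
Qed.

Lemma card_setUD (T : finType) (x D S : {set T}) :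
  [disjoint x & D] -> S \subset D ->
  #|x :|: (D :\: S)| = #|x| + (#|D| - #|S|).
Proof.
move=> xD SD; rewrite cardsU cardsD (setIidPr SD).
suff -> : x :&: (D :\: S) = set0 by rewrite cards0 subn0.
by apply/eqP; rewrite setI_eq0; apply: disjointWr xD; apply: subsetDl.
Qed.

(* [missing F D x] is the set I(x), and [outer_full F D] the set A, of the header. *)
Definition missing (T : finType) (F : {set {set T}}) (D x : {set T}) : {set T} :=
  [set i in D | [disjoint x & D] && (x :|: (D :\ i) \in F)].

Lemma missing_sub (T : finType) (F : {set {set T}}) (D x : {set T}) :
  missing F D x \subset D.
Proof. by apply/subsetP => i; rewrite inE => /andP[]. Qed.

Definition outer_full (T : finType) (F : {set {set T}}) (D : {set T}) :
    {set {set T}} :=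
  [set y : {set T} | [disjoint y & D] && (y :|: D \in F)].

(** Each [A] in [F] misses at most one point of [D], so its trace on [D] is [D] or some [D :\ i]. *)
Lemma leq_card_semistar (T : finType) (F : {set {set T}}) (D : {set T}) :
  (forall A, A \in F -> #|D| <= #|A :&: D|.+1) ->
  #|F| <= #|outer_full F D| + \sum_x #|missing F D x|.
Proof.
move=> star; rewrite -card_dep_pairs.
pose f1 (y : {set T}) := y :|: D.
pose f2 (p : {set T} * T) := p.1 :|: (D :\ p.2).
set P := [set p : {set T} * T | _].
apply: (@leq_trans (#|f1 @: outer_full F D| + #|f2 @: P|)); last first.
  by rewrite leq_add ?leq_imset_card.
apply: leq_trans (leq_card_setU _ _); apply: subset_leq_card.
apply/subsetP => A AF; rewrite inE.
have dAD : [disjoint A :\: D & D] by rewrite -setI_eq0 setIDAC setDIl setDv setI0.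
case: (boolP (D \subset A)) => [DA | /subsetPn[i iD iA]]; apply/orP.
  have eA : A :\: D :|: D = A.
    by rewrite setUC setDE setUIr setUCr setIT; apply/setUidPr.
  by left; apply/imsetP; exists (A :\: D); rewrite ?inE ?eA ?dAD.
have eI : A :&: D = D :\ i.
  apply/eqP; rewrite eqEcard; apply/andP; split.
    by rewrite subsetD1 subsetIr !inE (negbTE iA).
  by have := star A AF; rewrite (cardsD1 i D) iD ltnS.
have eA : A :\: D :|: (D :\ i) = A by rewrite -eI setUC setID.
by right; apply/imsetP; exists (A :\: D, i); rewrite /f2 ?inE /= ?eA ?iD ?dAD.
Qed.

(** * The shadow bound for a semistar, in integer form *)

Lemma semistar_leq_shadow (n k t j : nat) (F : {set {set 'I_n}})
    (D : {set 'I_n}) :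
  t < k -> j < t -> F \subset ksubsets n k -> t_intersecting t F ->
  #|D| = t.+1 -> (forall A, A \in F -> t <= #|A :&: D|) ->
  'C(t.+1, j) * #|F| <= j.+1 * #|shadow k j F|.
Proof.
move=> tk jt /subsetP Fk Fint cD star.
have cF (A : {set 'I_n}) : A \in F -> #|A| = k by move/Fk; rewrite inE => /eqP.
have jt1 : j <= t.+1 by rewrite ltnW // ltnS ltnW.
pose I := missing F D.
pose H : {set {set 'I_n}} := [set x | t.+1 - j < #|I x|].
pose Y := outer_full F D :|: shadow (k - t) 1 H.
have ID x : I x \subset D by exact: missing_sub.
have Idisj x i : i \in I x -> [disjoint x & D] by rewrite inE => /and3P[].
have IF x i : i \in I x -> x :|: (D :\ i) \in F by rewrite inE => /and3P[].
have Icard x i : i \in I x -> #|x| = k - t.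
  move=> ix; have := cF _ (IF _ _ ix); rewrite card_setUD ?(Idisj _ _ ix) //.
    by rewrite cD cards1 subn1 => <-; rewrite addnK.
  by rewrite sub1set (subsetP (ID x)).
have HI x : x \in H -> exists i, i \in I x.
  by rewrite inE => /(leq_ltn_trans (leq0n _)); rewrite card_gt0 => /set0Pn.
have Hk : H \subset ksubsets n (k - t).
  by apply/subsetP => x /HI[i /Icard cx]; rewrite inE cx.
have Hint : t_intersecting 1 H.
  move=> x y xH yH; have [i ix] := HI x xH.
  (* Since [j < t], the threshold [t.+1 - j] is at least 2, so [I y] has a point other than [i]. *)
  have /card_gt0P [l] : 0 < #|I y :\ i|.
    move: yH; rewrite inE (cardsD1 i (I y)) => cy; rewrite -ltnS.
    have : 2 <= t.+1 - j by rewrite ltn_subRL addn1 ltnS.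
    move=> h; apply: leq_trans (ltnW (leq_ltn_trans h cy)) _.
    by rewrite -add1n leq_add2r leq_b1.
  rewrite !inE -/(I y) => /andP[li ly].
  have ly' : l \in I y by rewrite inE.
  have iD := subsetP (ID _) _ ix; have lD := subsetP (ID _) _ ly'.
  have := Fint _ _ (IF _ _ ix) (IF _ _ ly').
  set Z := _ :&: _ => cZ.
  have cDil : #|D :\ i :\ l| = t.-1.
    have := cardsD1 l (D :\ i); rewrite !inE li lD /=.
    by have := cardsD1 i D; rewrite iD cD => /eqP; rewrite eqSS => /eqP <- ->.
  (* Inside [D] the two sets share only [t - 1] points, so the [t]-th common point lies in
     [x :&: y]. *)
  have sZ : Z \subset (x :&: y) :|: (D :\ i :\ l).
    have xD := Idisj _ _ ix; have yD := Idisj _ _ ly'.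
    apply/subsetP => z; rewrite !inE => /andP[].
    case/orP => [zx|/andP[-> zD]]; case/orP => [zy|/andP[-> zD']].
    - by rewrite zx zy.
    - by rewrite (disjointFr xD zx) in zD'.
    - by rewrite (disjointFr yD zy) in zD.
    - by rewrite zD orbT.
  have := leq_trans cZ (leq_trans (subset_leq_card sZ) (leq_card_setU _ _)).
  rewrite cDil; case: #|x :&: y| => //.
  by rewrite add0n leqNgt ltn_predL (leq_ltn_trans (leq0n j) jt).
have Ydisj y : y \in Y -> [disjoint y & D].
  rewrite !inE => /orP[/andP[] // | /andP[_ /existsP[x /andP[xH yx]]]].
  by have [i /Idisj] := HI x xH; apply: disjointWl.
have Ycard y : y \in Y -> #|y| = k - t.+1.
  rewrite !inE => /orP[/andP[yD /cF] | /andP[/eqP-> _]]; last first.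
    by rewrite -subnDA addn1.
  have := card_setUD yD (sub0set D); rewrite setD0 cards0 subn0 cD => -> <-.
  by rewrite addnK.
(* [P1] and [P2] code the two kinds of shadow members; the size of [S], [j+1] or [j], keeps them
   apart. *)
pose meet x :=
  [set S : {set 'I_n} | [&& S \subset D, #|S| == j.+1 & ~~ [disjoint S & I x]]].
pose P1 := [set p : {set 'I_n} * {set 'I_n} | p.2 \in meet p.1].
pose P2 := setX Y [set S : {set 'I_n} | S \subset D & #|S| == j].
have P1P p : p \in P1 ->
    [/\ p.2 \subset D, #|p.2| = j.+1 & exists2 i, i \in p.2 & i \in I p.1].
  rewrite !inE => /and3P[-> /eqP-> /pred0Pn[i /andP[ip iI]]]; split=> //.
  by exists i.
have P2P p : p \in P2 -> [/\ p.2 \subset D, #|p.2| = j & p.1 \in Y].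
  by rewrite !inE => /andP[pY /andP[-> /eqP->]].
have PP p : p \in P1 :|: P2 -> [disjoint p.1 & D] /\ p.2 \subset D.
  rewrite inE => /orP[/P1P[-> _ [i _ /Idisj]] // | /P2P[-> _ /Ydisj //]].
pose f (p : {set 'I_n} * {set 'I_n}) := p.1 :|: (D :\: p.2).
have f_inj : {in P1 :|: P2 &, injective f}.
  move=> [x S] [y S'] /PP[/= xD SD] /PP[/= yD SD'] e.
  rewrite -(setUD_outer S xD) -{2}(setUD_inner xD SD).
  by move: e; rewrite /f /= => ->; rewrite setUD_outer ?setUD_inner.
have f_sh : f @: (P1 :|: P2) \subset shadow k j F.
  apply/subsetP => _ /imsetP[p pP ->]; have [pD pS] := PP p pP.
  rewrite !inE card_setUD // cD; move: pP; rewrite inE => /orP[/P1P | /P2P].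
    case=> _ cp [i ip iI]; rewrite cp (Icard _ _ iI) subSS.
    rewrite addnBA 1?ltnW // subnK 1?ltnW // eqxx /=.
    apply/existsP; exists (p.1 :|: (D :\ i)); rewrite IF //=.
    by rewrite setUS // setDS // sub1set.
  case=> _ cp pY; rewrite cp (Ycard _ pY).
  rewrite addnBA ?subnK ?eqxx //=.
  move: pY; rewrite !inE => /orP[/andP[_ yF] | /andP[_ /existsP[x /andP[xH yx]]]].
    by apply/existsP; exists (p.1 :|: D); rewrite yF setUS // subsetDl.
  (* Otherwise [p.2] and [I x] would be disjoint in [D] with more than [t+1] points in total. *)
  have /pred0Pn[i /andP[/= ip iI]] : ~~ [disjoint p.2 & I x].
    apply/negP => dis; move: xH; rewrite inE ltnNge => /negP; apply.
    rewrite leq_subRL // -cp -cD.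
    move: dis; rewrite -setI_eq0 => /eqP dis.
    have := cardsU p.2 (I x); rewrite dis cards0 subn0 => <-.
    by rewrite subset_leq_card // subUset pS ID.
  apply/existsP; exists (x :|: (D :\ i)); rewrite IF //=.
  by apply: setUSS => //; rewrite setDS // sub1set.
have cP : #|P1 :|: P2| = #|P1| + #|P2|.
  rewrite cardsU (_ : P1 :&: P2 = set0) ?cards0 ?subn0 //.
  apply/setP => p; rewrite in_set0; apply/negP.
  rewrite inE => /andP[/P1P[_ c1 _] /P2P[_ c2 _]].
  by move: c1; rewrite c2 => /n_Sn.
have cP2 : #|P2| = 'C(t.+1, j) * #|Y| by rewrite cardsX cards_draws cD mulnC.
have cP1 : 'C(t.+1, j) * (\sum_x minn #|I x| (t.+1 - j)) <= j.+1 * #|P1|.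
  rewrite card_dep_pairs !big_distrr /=; apply: leq_sum => x _.
  rewrite card_draws_meeting // cD; apply: leq_bin_meeting.
  by rewrite -cD subset_leq_card.
(* Of the [j+1] copies of [Y], one pays for [outer_full F D] and [j] pay for [H] through its
   shadow. *)
have cY : #|outer_full F D| + j * #|H| <= j.+1 * #|Y|.
  rewrite mulSn leq_add ?subset_leq_card ?subsetUl // leq_mul2l; apply/orP; right.
  apply: leq_trans (intersecting_leq_shadow Hk Hint) _.
  by rewrite subset_leq_card // subsetUr.
(* Truncation loses at most [(t+1) - (t+1-j) = j], and only for [x] in [H]. *)
have cI : \sum_x #|I x| <= \sum_x minn #|I x| (t.+1 - j) + j * #|H|.
  rewrite -sum1_card big_distrr [X in _ + X]big_mkcond -big_split /=.
  apply: leq_sum => x _; rewrite inE; case: (leqP #|I x|) => [_|Ix].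
    by rewrite leq_addr.
  by rewrite muln1 subnK // -cD subset_leq_card.
have cFI : #|F| <= #|outer_full F D| + \sum_x #|I x|.
  by apply: leq_card_semistar => A /star; rewrite cD ltnS.
have := subset_leq_card f_sh; rewrite card_in_imset // cP => /(leq_mul (leqnn j.+1)).
apply: leq_trans; rewrite mulnDr cP2 mulnCA.
apply: leq_trans (leq_add cP1 (leqnn _)); rewrite -mulnDr leq_mul2l; apply/orP; right.
apply: leq_trans cFI _.
apply: leq_trans (leq_add (leqnn _) cI) _.
by rewrite addnCA leq_add2l.
Qed.

Local Close Scope nat_scope.

Theorem theorem5p5 (n k t : nat) (F : {set {set 'I_n}})
  (ht : (0 < t)%N) (htk : (t < k)%N) (hkn : (k < n)%N)
  (hF0 : F != set0) (hFk : F \subset ksubsets n k)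
  (hint : t_intersecting t F) (hstar : semistar t F) :
  forall j : nat, (1 < j)%N -> (j < t)%N ->
    (#|shadow k j F|%:R / #|F|%:R : rat)
      >= 1 / (t + 2)%:R * 'C(t + 2, j + 1)%:R.
Proof.
move=> j _ jt; have [D [cD star]] := hstar.
have main := semistar_leq_shadow htk jt hFk hint cD star.
have F_gt0 : (0 < #|F|)%N by rewrite card_gt0.
rewrite mul1r mulrC ler_pdivrMr ?ltr0n ?addn2 // mulrAC ler_pdivlMr ?ltr0n //.
(* After multiplying by [j+1], the identity [(j+1) C(t+2,j+1) = (t+2) C(t+1,j)] reduces the goal to
   [main]. *)
rewrite -!natrM ler_nat addn1 -(leq_pmul2l (ltn0Sn j)).
rewrite mulnA -mul_bin_diag mulnA [X in (_ <= X)%N]mulnC -mulnA.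
by rewrite leq_mul2l main orbT.
Qed.
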